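(* Let $r\geq 0$ and $k_1,\dots,k_r,k\geq 0$ be integers. The polynomial $\operatorname{t}(c^{k_1}dc^{k_2}d\cdots c^{k_r}dc^{k},x)$ is zero if at least one of $k_1,k_2,\ldots,k_r$ is odd. If $k_1,k_2,\ldots,k_r$ are all even then $$ \operatorname{t}(c^{k_1}dc^{k_2}d\cdots c^{k_r}dc^{k},x)= (-1)^{\frac{k_1+\cdots+k_r}{2}}\, C_{\frac{k_1}{2}}\cdots C_{\frac{k_r}{2}}\, \widetilde{Q}_{k}(x), $$ where $C_m=\frac{1}{m+1}\binom{2m}{m}$ is a Catalan number, and the polynomials $\widetilde{Q}_n(x)$ are given by $\widetilde{Q}_0(x)=1$ and $$ \widetilde{Q}_n(x)=\sum_{j=0}^{\left\lfloor \frac{n-1}{2}\right\rfloor}(-1)^j \left(\binom{n-1}{j}-\binom{n-1}{j-1}\right)x^{n-2j}\quad\text{for } n\geq 1. $$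
   Context: A $cd$-word is a word in the letters $c$ (degree $1$) and $d$ (degree $2$). In a $cd$-word of degree $n$, reading from left to right, each $c$ covers one position and each $d$ covers two consecutive positions of $[1,n]=\{1,\dots,n\}$. For $\lambda\in\{-1,1\}^n$, $R(\lambda)=\{i\in[1,n]:\lambda_1+\cdots+\lambda_i=0\}$ and $R(\lambda)-1=\{i-1:i\in R(\lambda)\}$. For a $cd$-word $w$ of degree $n$, $\operatorname{t}(w,x)$ is the total weight of all $\lambda\in\{-1,1\}^n$ such that the set of positions covered by letters $d$ in $w$ equals $R(\lambda)\cup(R(\lambda)-1)$ and $\lambda_1+\cdots+\lambda_i\geq 0$ for all $i\in[1,n]$. The weight of $\lambda$ is the product of a factor $-1/x$ for each $\lambda_i=-1$, a factor $x$ for each $\lambda_i=1$, and an additional factor $-1$ for each element of $R(\lambda)$. (For the empty word, $\operatorname{t}(w,x)=1$.) Convention: $\binom{m}{-1}=0$. *)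

(* Defs.v *)
From HB Require Import structures.
From mathcomp Require Import all_boot all_order all_algebra.
From mathcomp Require Import fraction.

Set Implicit Arguments.
Unset Strict Implicit.
Unset Printing Implicit Defensive.

Import Order.TTheory GRing.Theory Num.Theory.
Local Open Scope ring_scope.

Inductive cdletter := Lc | Ld.

Definition cdword := seq cdletter.

Definition letter_degree (l : cdletter) : nat :=
  match l with Lc => 1%N | Ld => 2%N end.

Definition cd_degree (w : cdword) : nat :=
  (\sum_(l <- w) letter_degree l)%N.

(* The (1-based) positions covered by the letters d of w, when w is placed
   after m positions that are already covered. *)
Fixpoint d_positions (m : nat) (w : cdword) : seq nat :=
  match w with
  | [::] => [::]
  | Lc :: w' => d_positions m.+1 w'
  | Ld :: w' => m.+1 :: m.+2 :: d_positions m.+2 w'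
  end.

(* Positions live in 'I_n.+1 = {0, ..., n}, so that R(lambda) - 1, which is a
   priori a subset of [0, n-1], and the subsets of [1, n] have the same type. *)
Definition d_cover (w : cdword) : {set 'I_(cd_degree w).+1} :=
  [set i : 'I_(cd_degree w).+1 | (i : nat) \in d_positions 0 w].

(* A sign vector in {-1,1}^n is lam : {ffun 'I_n -> bool}; the entry
   lambda_(j+1) is 1 if lam j is true and -1 otherwise. *)
Section SignVectors.
Variable n : nat.
Implicit Type lam : {ffun 'I_n -> bool}.

Definition sgn_entry lam (j : 'I_n) : int := if lam j then 1 else -1.

(* lambda_1 + ... + lambda_i *)
Definition partial_sum lam (i : nat) : int :=
  \sum_(j < n | (j < i)%N) sgn_entry lam j.

Definition Rset lam : {set 'I_n.+1} :=
  [set i : 'I_n.+1 | (0 < i)%N && (partial_sum lam i == 0)].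

Definition Rset_pred lam : {set 'I_n.+1} :=
  [set j : 'I_n.+1 | [exists i in Rset lam, (i : nat) == j.+1]].

Definition nonneg_sums lam : bool :=
  [forall i : 'I_n, 0 <= partial_sum lam i.+1].

Definition weight (F : fieldType) (x : F) lam : F :=
  (\prod_(j < n) (if lam j then x else (-1) / x)) * (-1) ^+ #|Rset lam|.

End SignVectors.

Definition tpoly (F : fieldType) (w : cdword) (x : F) : F :=
  \sum_(lam : {ffun 'I_(cd_degree w) -> bool} |
         (d_cover w == Rset lam :|: Rset_pred lam) && nonneg_sums lam)
     weight x lam.

(* c^{k_1} d c^{k_2} d ... c^{k_r} d c^k *)
Definition cdword_of (ks : seq nat) (k : nat) : cdword :=
  flatten [seq rcons (nseq m Lc) Ld | m <- ks] ++ nseq k Lc.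

Definition catalan (m : nat) : rat := (m.+1%:R)^-1 * 'C(m.*2, m)%:R.

(* binom(m, j - 1), with binom(m, -1) = 0 *)
Definition binom_pred (m j : nat) : nat :=
  if j is j'.+1 then 'C(m, j') else 0%N.

Definition Qtilde (n : nat) : {poly rat} :=
  if n is 0 then 1 else
  \sum_(j < (n.-1)./2.+1)
     ((-1) ^+ j * ('C(n.-1, j)%:R - (binom_pred n.-1 j)%:R)) *: 'X^(n - j.*2).

(* Main.v *)
(* A zero of the partial sums can only occur at an even position and forces the
   two positions ending there to be covered by d, so the positive excursions of
   lambda are matched with the blocks c^{k_i} d of the word, and the positive
   path after the last zero with the final block c^k.  Summing step by step,
   the weight of a block satisfies
     P (k+1) h = x P k (h+1) - x^-1 P k (h-1),
   whose solution for arbitrary boundary values P 0 is a combination of ballot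
   numbers.  Boundary values supported at 0 give the Catalan numbers and the
   vanishing for odd k_i; constant boundary values give the polynomial Qtilde. *)

Require Import Defs.
From mathcomp Require Import all_boot all_order all_algebra.
From mathcomp Require Import fraction ring zify.

Set Implicit Arguments.
Unset Strict Implicit.
Unset Printing Implicit Defensive.

Import Order.TTheory GRing.Theory Num.Theory.
Local Open Scope ring_scope.

(** * Covered positions as a boolean sequence *)

Fixpoint marks (w : cdword) : seq bool :=
  match w with
  | [::] => [::]
  | Lc :: w' => false :: marks w'
  | Ld :: w' => [:: true, true & marks w']
  end.

Lemma size_marks w : size (marks w) = cd_degree w.
Proof.
rewrite /cd_degree; elim: w => [|[] w IH] /=; rewrite ?big_nil ?big_cons ?IH //.
Qed.

Lemma mem_d_positions w (m i : nat) :
  (i \in d_positions m w) = (m < i)%N && nth false (marks w) (i - m.+1).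
Proof.
elim: w m i => [|[] w IH] m i /=; first by rewrite nth_nil andbF.
  rewrite IH; case: (ltngtP m.+1 i) => h /=.
  - by rewrite (_ : (i - m.+1)%N = (i - m.+2).+1) //; lia.
  - by [].
  - by rewrite h subnn.
rewrite !inE {}IH.
case: (ltngtP i m.+1) => h /=.
- by rewrite (ltn_eqF (leqW h)) ltnNge (leqW (ltnW h)).
- case: (ltngtP i m.+2) => h' /=; first by lia.
    by rewrite (_ : (i - m.+1)%N = (i - m.+3).+2) //=; lia.
  by rewrite h' (_ : (m.+2 - m.+1)%N = 1%N) //; lia.
- by rewrite h subnn.
Qed.

Lemma big_tuple_cons (R : nmodType) (T : finType) n (P : pred (seq T))
    (f : seq T -> R) :
  \sum_(t : n.+1.-tuple T | P t) f t =
  \sum_(b : T) \sum_(t : n.-tuple T | P (b :: t)) f (b :: t).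
Proof.
rewrite pair_big_dep /= (reindex (fun p : T * n.-tuple T => cons_tuple p.1 p.2)) //.
exists (fun t : n.+1.-tuple T => (thead t, behead_tuple t)) => [[b t] _|t _].
  by rewrite theadE; congr pair; apply/val_inj.
by rewrite [RHS]tuple_eta; apply/val_inj.
Qed.

(** * Ballot numbers and Catalan numbers *)

(* For R = int, the number of nonnegative +-1 paths starting at height h with
   j down-steps and k - j up-steps, provided 2j <= h + k; the second binomial
   is the reflection principle. *)
Definition ballot (R : pzRingType) (h k j : nat) : R :=
  'C(k, j)%:R - (binom_pred k (j - h))%:R.

Lemma binom_predS k j : binom_pred k.+1 j.+1 = (binom_pred k j.+1 + binom_pred k j)%N.
Proof. by case: j => [|j] /=; rewrite ?bin0 // binS. Qed.

Lemma ballot0 R h k : ballot R h k 0 = 1.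
Proof. by rewrite /ballot bin0 subr0. Qed.

(** From height [0] the first step must go up, so there is no down-step term. *)
Lemma ballot0S R k j : ballot R 0 k.+1 j.+1 = ballot R 1 k j.+1.
Proof.
rewrite /ballot !subn0 subn1 binom_predS binS /= !natrD.
by rewrite opprD addrA addrK.
Qed.

(** Pascal's rule on both binomials, which amounts to splitting by the first step. *)
Lemma ballotSS R h k j :
  ballot R h.+1 k.+1 j.+1 = ballot R h.+2 k j.+1 + ballot R h k j.
Proof.
have binomE : binom_pred k.+1 (j - h) = (binom_pred k (j - h.+1) + binom_pred k (j - h))%N.
  by rewrite subnS; case: (j - h)%N => [|i] //; rewrite addnC; exact: binom_predS.
by rewrite /ballot !subSS binS binomE !natrD opprD addrACA.
Qed.

Lemma catalan_ballot m : catalan m = ballot rat 0 m.*2 m.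
Proof.
rewrite /catalan /ballot subn0; case: m => [|m]; first by rewrite bin0 invr1 mul1r subr0.
(* The ratio of adjacent binomials lets the subtracted one be eliminated. *)
have := mul_bin_left m.+1.*2 m; rewrite (_ : m.+1.*2 - m = m.+2)%N; last by lia.
move=> /(congr1 (fun n => n%:R : rat)); rewrite !natrM /=.
have m2_neq0 : m.+2%:R != 0 :> rat by rewrite pnatr_eq0.
have m2E : m.+2%:R = m.+1%:R + 1 :> rat by rewrite -natr1.
move=> E; apply: (mulfI m2_neq0); rewrite mulrA mulfV // mulrBr mul1r -E m2E.
by rewrite mulrDl mul1r addrAC subrr add0r.
Qed.

(** * Weighted paths with marked positions *)

Section Paths.
Variables (F : fieldType) (x : F).

Definition step (b : bool) : int := if b then 1 else -1.

Definition height (h : int) (t : seq bool) (i : nat) : int :=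
  h + \sum_(b <- take i t) step b.

(* The marks s tell which of the positions still to be visited are covered by d,
   and m does so for the current one.  At the origin of the whole path the state
   is m = true and h = 0, the same as just after a return to 0. *)
Definition admissible (m : bool) (h : int) (s t : seq bool) : bool :=
  all (fun i => (0 <= height h t i) &&
         (nth false (m :: s) i ==
            (height h t i == 0) || (i < size t)%N && (height h t i.+1 == 0)))
      (iota 0 (size t).+1).

(** The sign of a return to [0] sits on the step arriving there, so the starting height contributes
    none. *)
Definition pathweight (h : int) (t : seq bool) : F :=
  \prod_(i < size t)
     ((if nth false t i then x else -1 / x) * (-1) ^+ (height h t i.+1 == 0)).

Definition pathsum (m : bool) (h : int) (s : seq bool) : F :=
  \sum_(t : (size s).-tuple bool | admissible m h s t) pathweight h t.

Lemma height0 h t : height h t 0 = h.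
Proof. by rewrite /height take0 big_nil addr0. Qed.

Lemma height_cons h b t i : height h (b :: t) i.+1 = height (h + step b) t i.
Proof. by rewrite /height /= big_cons addrA. Qed.

Lemma admissible_cons m h m' s b t :
  admissible m h (m' :: s) (b :: t) =
  [&& 0 <= h, m == (h == 0) || (h + step b == 0)
    & admissible m' (h + step b) s t].
Proof.
have all_iotaS (p : pred nat) n :
    all p (iota 0 n.+1) = p 0%N && all (fun i => p i.+1) (iota 0 n).
  by rewrite -[iota 0 n.+1]/(0%N :: iota (1 + 0) n) iotaDl /= all_map.
rewrite /admissible all_iotaS !height_cons !height0 -andbA; congr [&& _, _ & _].
by apply: eq_all => i; rewrite !height_cons.
Qed.

Lemma pathweight_cons h b t :
  pathweight h (b :: t) =
  (if b then x else -1 / x) * (-1) ^+ (h + step b == 0) * pathweight (h + step b) t.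
Proof.
rewrite /pathweight big_ord_recl /= height_cons height0; congr (_ * _).
by apply: eq_bigr => i _; rewrite height_cons.
Qed.

Lemma pathsum_nil m h : pathsum m h [::] = ((0 <= h) && (m == (h == 0)))%:R.
Proof.
rewrite /pathsum (eq_bigl (fun=> (0 <= h) && (m == (h == 0)))); last first.
  by move=> t; rewrite [t]tuple0 /admissible /= height0 orbF andbT.
case: (_ && _); last by rewrite big_pred0.
rewrite (big_pred1 [tuple]) => [|t]; first by rewrite /pathweight big_ord0.
by rewrite [t]tuple0; exact/esym/eqxx.
Qed.

Lemma pathsum_cons m h m' s :
  pathsum m h (m' :: s) =
  \sum_(b : bool)
    if (0 <= h) && (m == (h == 0) || (h + step b == 0)) then
      (if b then x else -1 / x) * (-1) ^+ (h + step b == 0) *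
        pathsum m' (h + step b) s
    else 0.
Proof.
rewrite /pathsum big_tuple_cons; apply: eq_bigr => b _.
case: ifP => hb.
  rewrite big_distrr /=; apply: eq_big => t; last by rewrite pathweight_cons.
  by rewrite admissible_cons andbA hb.
by rewrite big_pred0 // => t; rewrite admissible_cons andbA hb.
Qed.

Lemma tpoly_pathsum w : tpoly w x = pathsum true 0 (marks w).
Proof.
rewrite /tpoly /pathsum size_marks; set n := cd_degree w.
pose phi (t : n.-tuple bool) : {ffun 'I_n -> bool} := [ffun i => tnth t i].
rewrite (reindex phi); last first.
  exists (fun f : {ffun 'I_n -> bool} => mktuple f) => [t _|f _].
    by apply: eq_from_tnth => i; rewrite tnth_mktuple ffunE.
  by apply/ffunP => i; rewrite ffunE tnth_mktuple.
have psE (t : n.-tuple bool) i : (i <= n)%N -> partial_sum (phi t) i = height 0 t i.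
  move=> le_in; rewrite /height add0r /partial_sum (big_nth false).
  rewrite size_takel ?size_tuple // big_mkord.
  rewrite (big_ord_widen n (fun j => step (nth false (take i t) j)) le_in).
  by apply: eq_bigr => j lt_ji; rewrite nth_take // /sgn_entry ffunE (tnth_nth false).
have inR t (i : 'I_n.+1) : (i \in Rset (phi t)) = (0 < i)%N && (height 0 t i == 0).
  by rewrite inE psE // -ltnS.
have inRp t (i : 'I_n.+1) :
    (i \in Rset_pred (phi t)) = (i < n)%N && (height 0 t i.+1 == 0).
  rewrite inE; apply/exists_inP/andP => [[j jR /eqP ji]|[lt_in h0]].
    by move: jR (ltn_ord j); rewrite inR ji ltnS => /andP[_ ->].
  by exists (Ordinal (lt_in : i.+1 < n.+1)%N); rewrite ?inR.
have inD (i : 'I_n.+1) :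
    (i \in d_cover w) = (0 < i)%N && nth false (true :: marks w) i.
  by rewrite inE mem_d_positions; case: (val i) => //= j; rewrite subn1.
apply: eq_big => t.
  apply/andP/allP => [[/eqP/setP E /forallP N] i|N].
    rewrite mem_iota size_tuple ltnS => /andP[_ le_in].
    case: i le_in => [|i] le_in; first by rewrite height0.
    have := N (Ordinal le_in); rewrite psE //= => ->.
    by have := E (Ordinal (le_in : i.+1 < n.+1)%N); rewrite inD in_setU inR inRp /= => ->.
  have {}N i : (i <= n)%N ->
      (0 <= height 0 t i) && (nth false (true :: marks w) i ==
      (height 0 t i == 0) || (i < n)%N && (height 0 t i.+1 == 0)).
    by move=> le_in; have := N i; rewrite size_tuple mem_iota ltnS; apply.
  split; last first.
    by apply/forallP => i; rewrite psE //; case/andP: (N i.+1 (ltn_ord i)).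
  apply/eqP/setP => i; rewrite in_setU inD inR inRp.
  have /N/andP[_ /eqP->] : (i <= n)%N by rewrite -ltnS.
  (* Position [0] is not in [Rset_pred]: the first partial sum is 1 or -1, never 0. *)
  case: (val i) => [|j] //=; case: (val t) (size_tuple t) => [/= <- //|b t' _].
  by rewrite height_cons height0; case: b; rewrite andbF.
move=> _; rewrite /weight /pathweight big_split /= size_tuple; congr (_ * _).
  by apply: eq_bigr => i _; rewrite ffunE (tnth_nth false).
rewrite prodrXr -sum1_card big_mkcond big_ord_recl inR /= add0n; congr (_ ^+ _).
by apply: eq_bigr => i _; rewrite inR; case: eqP.
Qed.

Lemma pathsum_lt0 m h s : h < 0 -> pathsum m h s = 0.
Proof.
move=> h_lt0; rewrite /pathsum big_pred0 // => t.
by rewrite /admissible /= height0 leNgt h_lt0.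
Qed.

Lemma pathsum_return m s : pathsum true 0 (m :: s) = x * pathsum m 1 s.
Proof.
by rewrite pathsum_cons big_bool /= mulr1 (pathsum_lt0 _ (h := 0 + -1)) ?mulr0 ?addr0.
Qed.

(** An unmarked position cannot precede a zero, which rules out the down-step when [h = 0]. *)
Lemma pathsum_ascend h m s :
  pathsum false h.+1%:Z (m :: s) =
  x * pathsum m h.+2%:Z s - x^-1 * (if h is h'.+1 then pathsum m h'.+1%:Z s else 0).
Proof.
rewrite pathsum_cons big_bool /= (_ : h.+1%:Z + 1 = h.+2%:Z); last by lia.
rewrite (_ : h.+1%:Z + -1 = h%:Z); last by lia.
by case: h => [|h] /=; rewrite ?mulr1 ?mulr0 ?subr0 ?addr0 // mulN1r mulNr.
Qed.

(** A marked position at positive height must precede a zero, so the height is 1. The sign of the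
    down-step cancels that of the return. *)
Lemma pathsum_descend h m s :
  pathsum true h.+1%:Z (m :: s) = (h == 0)%:R * (x^-1 * pathsum m 0 s).
Proof.
rewrite pathsum_cons big_bool /= (_ : h.+1%:Z + -1 = h%:Z); last by lia.
by case: h => [|h] /=; rewrite ?mul0r ?add0r // mul1r expr1 mulrN1 mulN1r opprK.
Qed.

(** * Solving the path recurrence *)

Hypothesis x_neq0 : x != 0.

(** The index [j] counts down-steps, so the path ends at [h + k - j.*2]. The power of [x] is a
    quotient because [j.*2] may exceed [k]. *)
Lemma ballot_path_recurrence (P : nat -> nat -> F) :
    (forall k h, P k.+1 h =
       x * P k h.+1 - x^-1 * (if h is h'.+1 then P k h' else 0)) ->
  forall k h, P k h =
    \sum_(j < (h + k)./2.+1)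
      (-1) ^+ j * ballot F h k j * (x ^+ k / x ^+ j.*2) * P 0%N (h + k - j.*2)%N.
Proof.
move=> PS; elim=> [|k IHk] h.
  rewrite big_ord_recl big1 => [|j _].
    by rewrite ballot0 !mul1r invr1 mul1r addn0 subn0 addr0.
  rewrite /ballot bin0n /= (_ : bump 0 j - h = 0)%N ?subr0 ?mulr0 ?mul0r //.
  by rewrite /bump; case: j => j /=; lia.
rewrite PS !IHk; case: h => [|h].
  rewrite mulr0 subr0 mulr_sumr add0n add1n.
  apply: eq_bigr => -[[|j] _] _ /=; rewrite ?ballot0S ?ballot0 (exprS x k); ring.
rewrite (_ : h.+2 + k = (h + k).+2)%N // (_ : h.+1 + k.+1 = (h + k).+2)%N; last by lia.
(* Term [j] of the down-step branch pairs with term [j.+1] of the up-step branch; the term without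
   down-steps stands alone. *)
rewrite /= [X in x * X]big_ord_recl [RHS]big_ord_recl /= mulrDr -addrA.
congr (_ + _); first by rewrite !ballot0 (exprS x k); ring.
rewrite IHk !mulr_sumr -sumrB; apply: eq_bigr => j _.
rewrite /bump leq0n add1n ballotSS !doubleS !subSS (exprS x k).
rewrite !exprS; have := expf_neq0 j.*2 x_neq0.
move: (x ^+ j.*2) ((-1) ^+ j) (P _ _) => y e p y_neq0.
by field; rewrite ?x_neq0 ?y_neq0.
Qed.

Lemma pathsum_block k s :
  pathsum true 0 (nseq k false ++ [:: true, true & s]) =
  (if odd k then 0 else (-1) ^+ k./2 * ballot F 0 k k./2) * pathsum true 0 s.
Proof.
pose l i := nseq i false ++ [:: true, true & s].
have lE i : l i = head true (l i) :: behead (l i) by case: i.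
(* Heights are shifted by one: between returns the path stays at height at least 1. *)
pose P i h := pathsum (head true (l i)) h.+1%:Z (behead (l i)).
have PS i h : P i.+1 h = x * P i h.+1 - x^-1 * (if h is h'.+1 then P i h' else 0).
  by rewrite /P /= -/(l i) lE pathsum_ascend; case: h.
have P0 h : P 0%N h = (h == 0)%:R * (x^-1 * pathsum true 0 s).
  exact: pathsum_descend.
rewrite -/(l k) lE pathsum_return -[pathsum _ 1 _]/(P k 0%N).
(* The boundary value forces [k - j.*2 = 0]: only the last term can survive, and only for even
   [k]. *)
rewrite (ballot_path_recurrence PS) big_ord_recr big1 /= ?add0r => [|j _].
  rewrite P0 add0n; case: ifP => k_odd.
    by rewrite (_ : k - k./2.*2 = 1)%N ?mul0r ?mulr0 //; lia.
  rewrite (_ : k./2.*2 = k) ?subnn; last by lia.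
  by rewrite divff ?expf_neq0 // eqxx mulr1 mul1r mulrCA mulVKf.
by rewrite P0 (_ : (0 + k - j.*2 == 0)%N = false) ?mul0r ?mulr0 //; case: j => j /=; lia.
Qed.

(** After the last zero the path may end at any positive height, so all boundary values are 1. *)
Lemma pathsum_tail k :
  pathsum true 0 (nseq k.+1 false) =
  \sum_(j < k./2.+1) (-1) ^+ j * ballot F 0 k j * x ^+ (k.+1 - j.*2).
Proof.
pose P i h := pathsum false h.+1%:Z (nseq i false).
have PS i h : P i.+1 h = x * P i h.+1 - x^-1 * (if h is h'.+1 then P i h' else 0).
  exact: pathsum_ascend.
rewrite pathsum_return -[pathsum _ 1 _]/(P k 0%N) (ballot_path_recurrence PS) mulr_sumr.
apply: eq_bigr => j _; rewrite /P pathsum_nil mulr1 mulrCA; congr (_ * _).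
rewrite mulrA -exprS -expfB //; case: j => j /=; lia.
Qed.

Lemma pathsum_cdword ks k :
  pathsum true 0 (marks (cdword_of ks k)) =
  (\prod_(m <- ks) (if odd m then 0 else (-1) ^+ m./2 * ballot F 0 m m./2)) *
  pathsum true 0 (nseq k false).
Proof.
have marks_cat w1 w2 : marks (w1 ++ w2) = marks w1 ++ marks w2.
  by elim: w1 => [|[] w1 IH] //=; rewrite IH.
have marks_nseq m : marks (nseq m Lc) = nseq m false.
  by elim: m => //= m ->.
elim: ks => [|m ks IH]; first by rewrite big_nil mul1r /cdword_of /= marks_nseq.
rewrite /cdword_of /= -catA marks_cat -cats1 marks_cat marks_nseq -catA /=.
by rewrite pathsum_block IH big_cons mulrA.
Qed.

End Paths.

(** * Specialization to the indeterminate *)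

Lemma pathsum_tail_Qtilde k :
  pathsum (tofrac ('X : {poly rat})) true 0 (nseq k false) = tofrac (Qtilde k).
Proof.
case: k => [|k]; first by rewrite pathsum_nil tofrac1.
rewrite pathsum_tail ?tofrac_eq0 ?polyX_eq0 // /Qtilde rmorph_sum /=.
apply: eq_bigr => j _; rewrite -mul_polyC !rmorphM rmorphB /= !rmorphXn /=.
by rewrite !rmorphN1 !rmorphB /= !rmorph_nat /ballot subn0.
Qed.

Theorem proposition4p4 (r : nat) (ks : r.-tuple nat) (k : nat) :
  (has odd ks ->
     tpoly (cdword_of ks k) (tofrac ('X : {poly rat})) = 0)
  /\
  (all (fun m => ~~ odd m) ks ->
     tpoly (cdword_of ks k) (tofrac ('X : {poly rat})) =
     tofrac (((-1) ^+ ((\sum_(m <- ks) m)%N)./2 * \prod_(m <- ks) catalan m./2)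
               *: Qtilde k)).
Proof.
rewrite tpoly_pathsum pathsum_cdword ?tofrac_eq0 ?polyX_eq0 // pathsum_tail_Qtilde.
split=> [/hasP[m m_ks m_odd]|].
  by rewrite (big_rem m) //= m_odd !mul0r.
rewrite -mul_polyC rmorphM /=; move: (val ks) => {r}ks ks_even; congr (_ * _).
elim: ks ks_even => [|m ks IH] /=; first by rewrite !big_nil mulr1 rmorph1.
case/andP=> m_even ks_even; rewrite !big_cons (negbTE m_even) IH //.
rewrite catalan_ballot even_halfK //.
rewrite halfD (negbTE m_even) /= add0n exprD mulrACA !rmorphM /=; congr (_ * _).
rewrite /ballot !rmorphB !rmorphXn !rmorphN1 /=.
by rewrite !rmorph_nat.
Qed.
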